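(* Let $k\ge 1$ and $n\ge 1$ be integers and let $a$ be a positive integer or $a=\infty$. The map $\phi$ (defined in the context), restricted to the set $\mathcal{PP}^{k+1}_n(k,a)$ of $(k+1)$-peak colored $(k,a)$-paths of order $n$, is a bijection from $\mathcal{PP}^{k+1}_n(k,a)$ onto the set $\mathcal{S}''_n(k,a)$ of super $(k,a)$-paths of order $n$ which do not start with a horizontal step.
   Context: Paths. A $(k,a)$-path of order $n$ is a lattice path in $\mathbb{Z}\times\mathbb{Z}$ from $(0,0)$ to $(n,0)$ using up steps $U=(1,k)$, down steps $D=(1,-1)$ and horizontal steps $H=(a,0)$ and never going below the $x$-axis; for $a=\infty$ no horizontal steps are allowed. A super $(k,a)$-path of order $n$ is defined in the same way except that it is allowed to go below the $x$-axis. Paths are identified with words in the letters $U,D,H$. A section of a path is called a (possibly empty) $(k,a)$-path if its word is the word of a $(k,a)$-path, i.e. it starts and ends at the same height and never goes below that height. The reverse $\widehat{P}$ of a word $P=p_1p_2\cdots p_N$ is the word $p_N\cdots p_2p_1$. $H^{i}$ denotes $i$ consecutive horizontal steps. Humps, peaks and colorings. A hump in a path is an up step followed by zero or more horizontal steps followed by a down step (all consecutive), i.e. an occurrence of a factor $UH^{j}D$, $j\ge 0$. A peak is an up step immediately followed by a down step, i.e. a hump with $j=0$. An $m$-hump colored (resp. $m$-peak colored) $(k,a)$-path is a $(k,a)$-path in which exactly one hump (resp. peak) is selected and assigned one of the $m$ colors $1,\dots,m$. $\mathcal{PM}^{m}_n(k,a)$ (resp. $\mathcal{PP}^{m}_n(k,a)$)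 is the set of all $m$-hump colored (resp. $m$-peak colored) $(k,a)$-paths of order $n$; thus $\mathcal{PP}^{m}_n(k,a)\subseteq\mathcal{PM}^{m}_n(k,a)$. $\mathcal{S}''_n(k,a)$ is the set of all super $(k,a)$-paths of order $n$ which do not start with a horizontal step. The map $\phi$ (defined on $\mathcal{PM}^{k+1}_n(k,a)$). Let $P=p_1p_2\cdots p_N\in\mathcal{PM}^{k+1}_n(k,a)$ have colored hump $p_l p_{l+1}\cdots p_m=UH^{m-l-1}D$ with color $c\in\{1,\dots,k+1\}$, and suppose $p_l$ goes from $(x_1,h)$ to $(x_1+1,h+k)$, where $x_1,h\ge 0$. Then $P$ can be uniquely decomposed as $$P=R_1\,P'\,p_l\,H^{m-l-1}\,d_1\,R_2\,d_2\cdots R_k\,d_k\,P'',$$ where: for $1\le i\le k$, $d_i$ is the first step after $p_l$ that goes from the line $y=h+k+1-i$ to the line $y=h+k-i$ (so it is a down step); $P'$ is the (possibly empty) section of $P$ immediately to the left of $p_l$ which, when nonempty, starts with an up step on the $x$-axis and lies strictly above the $x$-axis except for its starting point; each $R_i$ is a (possibly empty) $(k,a)$-path; and $P''$ is the remaining section of $P$ after $d_k$ (going from height $h$ to the $x$-axis). The word $\phi(P)$, viewed as a path starting at $(0,0)$, is defined as follows: (i) if $c=1$, $\phi(P)=H^{m-l-1}\,p_l\,R_1d_1R_2d_2\cdots R_kd_k\,P''P'$; (ii) if $c=k+1$, $\phi(P)=H^{m-l-1}\,d_1\widehat{R_1}\,d_2\widehat{R_2}\cdots d_k\widehat{R_k}\,p_l\,P''P'$;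 (iii) if $1<c<k+1$, $\phi(P)=H^{m-l-1}\,d_1\widehat{R_1}\,d_2\widehat{R_2}\cdots d_{c-1}\widehat{R_{c-1}}\,p_l\,R_cd_c\cdots R_kd_k\,P''P'$. *)

(* Defs.v *)
From mathcomp Require Import all_boot all_order all_algebra.
From mathcomp Require Export classical_sets functions.
Set Implicit Arguments.
Unset Strict Implicit.
Unset Printing Implicit Defensive.
Import Order.TTheory GRing.Theory Num.Theory.
Local Open Scope ring_scope.

Inductive step := U | D | H.

(* The parameter [a : option nat] is [Some b] for a = b and [None] for
   a = oo, in which case [H] is forbidden and its width is irrelevant. *)
Definition allowed (a : option nat) (s : step) : bool :=
  if s is H then isSome a else true.

Definition dx (a : option nat) (s : step) : nat :=
  if s is H then odflt 0%N a else 1%N.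

Definition dy (k : nat) (s : step) : int :=
  match s with U => k%:Z | D => -1 | H => 0 end.

Definition width (a : option nat) (w : seq step) : nat :=
  (\sum_(s <- w) dx a s)%N.

Definition height (k : nat) (w : seq step) : int := \sum_(s <- w) dy k s.

(* Ordinate of the endpoint of the first [i] steps. *)
Definition ordinate (k : nat) (w : seq step) (i : nat) : int :=
  height k (take i w).

Definition superpath (k : nat) (a : option nat) (n : nat) : set (seq step) :=
  [set w | [/\ all (allowed a) w, width a w = n & height k w = 0]].

Definition kapath (k : nat) (a : option nat) (n : nat) : set (seq step) :=
  [set w | superpath k a n w /\ forall i : nat, 0 <= ordinate k w i].

(* S''_n(k,a) *)
Definition superpath_noH (k : nat) (a : option nat) (n : nat) :
    set (seq step) :=
  [set w | superpath k a n w /\ ohead w <> Some H].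

(* An occurrence of U H^j D whose up step has (0-based) index [l]. *)
Definition hump_at (w : seq step) (l j : nat) : Prop :=
  exists A B : seq step, w = A ++ U :: nseq j H ++ D :: B /\ size A = l.

(* A word, the index of the up step of the selected hump, and its color. *)
Record colored_word := ColoredWord {
  word : seq step;
  hump_pos : nat;
  color : nat
}.

(* PM^m_n(k,a) *)
Definition hump_colored (m k : nat) (a : option nat) (n : nat) :
    set colored_word :=
  [set P | [/\ kapath k a n (word P),
               exists j : nat, hump_at (word P) (hump_pos P) j
             & (1 <= color P <= m)%N]].

(* PP^m_n(k,a) *)
Definition peak_colored (m k : nat) (a : option nat) (n : nat) :
    set colored_word :=
  [set P | [/\ kapath k a n (word P),
               hump_at (word P) (hump_pos P) 0
             & (1 <= color P <= m)%N]].

Definition section (w : seq step) (i j : nat) : seq step := drop i (take j w).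

(* The pieces of
     P = R_1 P' p_l H^j d_1 R_2 d_2 ... R_k d_k P''
   for a word [w] whose selected up step has index [l] and starts at
   ordinate h. *)

(* Index of d_i: the first step after p_l from y = h+k+1-i to y = h+k-i. *)
Definition is_d (k : nat) (w : seq step) (l i q : nat) : bool :=
  let h := ordinate k w l in
  (ordinate k w q == h + k%:Z + 1 - i%:Z)
  && (ordinate k w q.+1 == h + k%:Z - i%:Z).

Definition dpos (k : nat) (w : seq step) (l i : nat) : nat :=
  (l.+1 + find (is_d k w l i) (iota l.+1 (size w - l.+1)))%N.

(* Last visit to the x-axis at or before the start of p_l.  P' is the section
   from there to p_l: either empty, or strictly above the axis after its
   starting point and hence starting with an up step. *)
Definition last_axis (k : nat) (w : seq step) (l : nat) : nat :=
  last 0%N [seq r <- iota 0 l.+1 | ordinate k w r == 0].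

Definition partR (k : nat) (w : seq step) (l i : nat) : seq step :=
  if i == 1%N then take (last_axis k w l) w
  else section w (dpos k w l i.-1).+1 (dpos k w l i).

Definition partP' (k : nat) (w : seq step) (l : nat) : seq step :=
  section w (last_axis k w l) l.

Definition partH (k : nat) (w : seq step) (l : nat) : seq step :=
  section w l.+1 (dpos k w l 1).

Definition partP'' (k : nat) (w : seq step) (l : nat) : seq step :=
  drop (dpos k w l k).+1 w.

(* The blocks are d_i rev(R_i) for i < c, placed before p_l, and R_i d_i for
   c <= i <= k, placed after it; the first group is empty when c = 1 and the
   second is empty when c = k+1.  The value is meaningful on
   [hump_colored k.+1 k a n] only. *)
Definition phi (k : nat) (P : colored_word) : seq step :=
  let w := word P in
  let l := hump_pos P in
  let c := color P in
  partH k w l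
  ++ flatten [seq D :: rev (partR k w l i) | i <- index_iota 1 c]
  ++ U :: flatten [seq rcons (partR k w l i) D | i <- index_iota c k.+1]
  ++ partP'' k w l ++ partP' k w l.

(* Main.v *)
Require Import Defs.
From mathcomp Require Import all_boot all_order all_algebra.
From HB Require Import structures.
From mathcomp Require Import zify.

Set Implicit Arguments.
Unset Strict Implicit.
Unset Printing Implicit Defensive.
Import Order.TTheory GRing.Theory Num.Theory.
Local Open Scope ring_scope.

(** A path with a selected peak and its image under [phi] are two ways of
    writing down the same data: a sequence [Rs] of [k] excursions (words of
    (k,a)-paths), a word [P'] that stays strictly above its starting point, and
    a word [P''] that ends at its lowest level, with opposite heights for [P']
    and [P''].  These are the [pieces]; [assemble] puts them together into the
    path, with the peak after [R_1 P'], and [rearrange c] into the super path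
      d_1 rev(R_1) ... d_(c-1) rev(R_(c-1)) U R_c d_c ... R_k d_k P'' P'.
    Both words are permutations of each other, so they have the same order, and
    the requirement that the assembled path stay above the axis is already part
    of the conditions on the pieces ([assemble_kapath]).

    On the side of the path, every path with a selected peak is assembled from
    pieces ([disassemble]), and the cutting points used by [phi] recover exactly
    these pieces, so that [phi] maps [assemble] to [rearrange]
    ([phi_assemble]).

    On the side of the super path, the color and the pieces can be read off from
    the word.  The distinguished up step is the first step of the word
    that ends at or above the axis ([first_return]): the blocks
    [d_i rev(R_i)] before it stay below the axis, and it starts at height
    [1 - c], which is at least [-k].  Every word with the properties of the
    part before it is, read backwards, a product of blocks [R D] with [R] an
    excursion; such a factorization is unique since each [D] is the first step
    below the current level ([passages], [passages_uniq]).  The same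
    factorization of what follows yields [R_c, ..., R_k], and the remaining word
    [P'' P'] is cut at its last minimum ([last_minimum],
    [last_minimum_uniq]).  All these cuts exist and are unique for an arbitrary
    nonempty super path that does not start with [H], so that [rearrange] is injective
    and surjective ([rearrange_inj], [rearrange_surj]). *)

Lemma step_comparable : comparable step.
Proof. by case; case; [left|right|right|right|left|right|right|right|left]. Qed.

HB.instance Definition _ := hasDecEq.Build step (compareP step_comparable).

(** * Ordinates *)

Lemma height_nil k : height k [::] = 0.
Proof. exact: big_nil. Qed.

Lemma height_cons k s w : height k (s :: w) = dy k s + height k w.
Proof. exact: big_cons. Qed.

Lemma height_cat k u v : height k (u ++ v) = height k u + height k v.
Proof. exact: big_cat. Qed.

Lemma height_rcons k w s : height k (rcons w s) = height k w + dy k s.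
Proof. by rewrite -cats1 height_cat height_cons height_nil addr0. Qed.

Lemma height_perm k u v : perm_eq u v -> height k u = height k v.
Proof. exact: perm_big. Qed.

Lemma height_rev k w : height k (rev w) = height k w.
Proof. by apply: height_perm; rewrite perm_rev. Qed.

Definition heightE := (height_nil, height_cons, height_cat, height_rcons,
  height_rev).

Lemma ordinate0 k w : ordinate k w 0 = 0.
Proof. by rewrite /ordinate take0 height_nil. Qed.

Lemma ordinate_oversize k w i : (size w <= i)%N -> ordinate k w i = height k w.
Proof. by move=> le_wi; rewrite /ordinate take_oversize. Qed.

Lemma ordinate_catl k u v i :
  (i <= size u)%N -> ordinate k (u ++ v) i = ordinate k u i.
Proof. by move=> le_iu; rewrite /ordinate takel_cat. Qed.

Lemma ordinate_catr k u v i :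
  ordinate k (u ++ v) (size u + i) = height k u + ordinate k v i.
Proof. by rewrite /ordinate take_cat ltnNge leq_addr addKn height_cat. Qed.

Lemma ordinate_size_cat k u v : ordinate k (u ++ v) (size u) = height k u.
Proof. by rewrite ordinate_catl // ordinate_oversize. Qed.

Lemma ordinate_cons k s w i :
  ordinate k (s :: w) i.+1 = dy k s + ordinate k w i.
Proof. by rewrite /ordinate /= height_cons. Qed.

Lemma ordinateS k w i : (i < size w)%N ->
  ordinate k w i.+1 = ordinate k w i + dy k (nth H w i).
Proof.
by move=> lt_iw; rewrite /ordinate (take_nth H) // height_rcons.
Qed.

Lemma ordinate_rev k w i :
  ordinate k (rev w) i = height k w - ordinate k w (size w - i).
Proof.
have := congr1 (height k) (cat_take_drop (size w - i) w).
by rewrite height_cat /ordinate take_rev height_rev; lia.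
Qed.

(** Bounds on the ordinates of a concatenation are checked on its factors, the
    second one being raised by the height of the first. *)
Lemma ordinate_cat_ind k u v (Q : nat -> int -> Prop) :
  (forall i, (i <= size u)%N -> Q i (ordinate k u i)) ->
  (forall i, Q (size u + i)%N (height k u + ordinate k v i)) ->
  forall i, Q i (ordinate k (u ++ v) i).
Proof.
move=> Qu Qv i; case: (leqP i (size u)) => [le_iu | /ltnW le_ui].
  by rewrite ordinate_catl //; apply: Qu.
by rewrite -(subnKC le_ui) ordinate_catr; apply: Qv.
Qed.

Lemma cat_eq_prefix (T : Type) (u v u' v' : seq T) :
  u ++ v = u' ++ v' -> (size u <= size u')%N ->
  exists2 z, u' = u ++ z & v = z ++ v'.
Proof.
move=> e le_uu'; exists (drop (size u) u').
  by rewrite -[LHS](cat_take_drop (size u)) -(takel_cat v') // -e take_size_cat.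
have := congr1 (drop (size u)) e.
by rewrite drop_size_cat // drop_cat; case: ltngtP le_uu' => // -> _ ->;
  rewrite subnn drop0 drop_size.
Qed.

(** * First passages *)

Definition excursion k w : bool :=
  (height k w == 0) && all (fun i => 0 <= ordinate k w i) (iota 0 (size w)).

Lemma excursionP k w :
  reflect (height k w = 0 /\ forall i, 0 <= ordinate k w i) (excursion k w).
Proof.
apply: (iffP andP) => [[/eqP h0 /allP pos]|[-> pos]]; split => //.
- move=> i; case: (ltnP i (size w)) => ltiw.
    by apply: pos; rewrite mem_iota.
  by rewrite ordinate_oversize // h0.
- by apply/allP.
Qed.

Lemma excursion_nil k : excursion k [::].
Proof. by rewrite /excursion height_nil eqxx. Qed.

Definition blocks (Rs : seq (seq step)) := flatten [seq rcons R D | R <- Rs].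

Lemma blocks_cons R Rs : blocks (R :: Rs) = R ++ D :: blocks Rs.
Proof. by rewrite /blocks /= cat_rcons. Qed.

Lemma blocks_cat Rs Rs' : blocks (Rs ++ Rs') = blocks Rs ++ blocks Rs'.
Proof. by rewrite /blocks map_cat flatten_cat. Qed.

Lemma height_blocks k Rs :
  all (excursion k) Rs -> height k (blocks Rs) = - (size Rs)%:Z.
Proof.
elim: Rs => [|R Rs IH] /=; first by rewrite height_nil.
move=> /andP[/excursionP[hR _] exRs].
by rewrite blocks_cons !heightE hR IH //= /dy; lia.
Qed.

(** Down steps have size one, so the first step to a negative ordinate is a down
    step from the starting level: the word before it is an excursion. *)
Lemma first_passage k w : height k w < 0 ->
  exists R w', w = R ++ D :: w' /\ excursion k R.
Proof.
move=> neg.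
have ex : exists i, ordinate k w i < 0.
  by exists (size w); rewrite ordinate_oversize.
case: (ex_minnP ex) => [[|j] negj minj]; first by rewrite ordinate0 in negj.
have pos i : (i <= j)%N -> 0 <= ordinate k w i.
  by move=> le_ij; rewrite leNgt; apply/negP => /minj; lia.
have ltjw : (j < size w)%N.
  rewrite ltnNge; apply/negP => lewj; have := pos j (leqnn j).
  by move: negj; rewrite !ordinate_oversize //; lia.
have wE : w = take j w ++ nth H w j :: drop j.+1 w.
  by rewrite -drop_nth // cat_take_drop.
have := pos j (leqnn j); move: negj; rewrite ordinateS // => negj posj.
have [sD j0] : nth H w j = D /\ ordinate k w j = 0.
  by move: negj; rewrite /dy; case: (nth H w j) => h; split=> //; lia.
exists (take j w), (drop j.+1 w); rewrite -sD; split=> //.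
apply/excursionP; split=> // i.
case: (leqP i j) => le_ij; first by rewrite /ordinate take_takel //; apply: pos.
rewrite ordinate_oversize; first by rewrite [height _ _]j0.
by rewrite size_takel ltnW.
Qed.

(** If one of the two excursions were longer, it would contain the down step that
    follows the other one and thus reach ordinate -1. *)
Lemma first_passage_uniq k R R' w w' :
  excursion k R -> excursion k R' -> R ++ D :: w = R' ++ D :: w' ->
  R = R' /\ w = w'.
Proof.
wlog le_RR' : R R' w w' / (size R <= size R')%N.
  move=> IH exR exR' e; case: (leqP (size R) (size R')) => [|/ltnW] le.
    exact: IH.
  by have [] := IH _ _ _ _ le exR' exR (esym e).
move=> /excursionP[hR _] /excursionP[_ posR'] e.
have [[|s z] R'E /= zs] := cat_eq_prefix e le_RR'.
  by rewrite R'E cats0; case: zs.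
case: zs => zs _.
have := posR' (size R + 1)%N.
by rewrite R'E ordinate_catr hR -zs /ordinate /= take0 !heightE /dy; lia.
Qed.

Lemma passages k m w : height k w <= - m%:Z ->
  exists Rs T, [/\ w = blocks Rs ++ T, size Rs = m & all (excursion k) Rs].
Proof.
elim: m w => [|m IH] w hw; first by exists [::], w.
have [|R [w' [wE exR]]] := @first_passage k w; first by lia.
have [|Rs [T [w'E sz exRs]]] := IH w'.
  by move: hw; rewrite wE !heightE; case/excursionP: exR => -> _; rewrite /dy; lia.
exists (R :: Rs), T; rewrite /= exR exRs sz; split=> //.
by rewrite blocks_cons wE w'E -catA.
Qed.

Lemma passages_uniq k Rs Rs' T T' :
  all (excursion k) Rs -> all (excursion k) Rs' -> size Rs = size Rs' ->
  blocks Rs ++ T = blocks Rs' ++ T' -> Rs = Rs' /\ T = T'.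
Proof.
elim: Rs Rs' => [|R Rs IH] [|R' Rs'] //= /andP[exR exRs] /andP[exR' exRs'] [sz].
rewrite !blocks_cons -!catA !cat_cons => e.
have [-> e'] := first_passage_uniq exR exR' e.
by have [-> ->] := IH _ exRs exRs' sz e'.
Qed.

Lemma ordinate_blocks_ge k Rs i :
  all (excursion k) Rs -> - (size Rs)%:Z <= ordinate k (blocks Rs) i.
Proof.
elim: Rs i => [|R Rs IH] i /=; first by rewrite /ordinate /= height_nil.
move=> /andP[/excursionP[hR posR] exRs]; rewrite blocks_cons.
apply: (ordinate_cat_ind (Q := fun _ y => _ <= y)) => {}i.
  by move=> _; have := posR i; lia.
rewrite hR; case: i => [|i]; rewrite ?ordinate0 ?ordinate_cons /dy; first by lia.
by have := IH i exRs; lia.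
Qed.

(** * Last minimum *)

(** The lowest level may be visited several times by a word that ends there, but
    a word that leaves up never comes back to its start; so [u ++ v] with
    [ends_lowest k u] and [leaves_up k v] is the cut at the last minimum. *)
Definition ends_lowest k w := forall i, height k w <= ordinate k w i.

Definition leaves_up k w :=
  forall i, (i < size w)%N -> 0 < ordinate k w i.+1.

Lemma ends_lowest_height k w : ends_lowest k w -> height k w <= 0.
Proof. by move=> /(_ 0%N); rewrite ordinate0. Qed.

Lemma ends_lowest_catr k u v : ends_lowest k (u ++ v) -> ends_lowest k v.
Proof.
by move=> low i; have := low (size u + i)%N; rewrite ordinate_catr height_cat lerD2l.
Qed.

Lemma leaves_up_ge0 k w i : leaves_up k w -> 0 <= ordinate k w i.
Proof.
move=> up; case: i => [|i]; first by rewrite ordinate0.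
case: (ltnP i (size w)) => [/up/ltW //|le_wi].
rewrite ordinate_oversize; last exact: leqW.
case: (posnP (size w)) => [/size0nil -> |lt0w]; first by rewrite height_nil.
have := up (size w).-1; rewrite prednK // ordinate_oversize // => h.
exact/ltW/h.
Qed.

Lemma last_minimum k w :
  exists u v, [/\ w = u ++ v, ends_lowest k u & leaves_up k v].
Proof.
(* A new first step [s] either lies on the left of the same cut or, if
   [s :: u] rises, moves the last minimum to the new origin. *)
elim: w => [|s w [u [v [-> low up]]]].
  by exists [::], [::]; split=> // i; rewrite /ordinate.
case: (lerP (height k (s :: u)) 0) => [le0|gt0].
  exists (s :: u), v; split=> // -[|i]; first by rewrite ordinate0.
  by rewrite ordinate_cons height_cons lerD2l.
exists [::], (s :: u ++ v); split=> // i _.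
rewrite ordinate_cons; apply: (lt_le_trans gt0); rewrite height_cons lerD2l.
apply: (ordinate_cat_ind (Q := fun _ y => _ <= y)) => {}i; first by move=> _; apply: low.
by rewrite lerDl; apply: leaves_up_ge0.
Qed.

(** Between two different cuts, say with [u] shorter than [u'], would lie a
    nonempty prefix of [v], which rises, that is also a suffix of [u'], which
    does not rise. *)
Lemma last_minimum_uniq k u v u' v' :
  ends_lowest k u -> leaves_up k v -> ends_lowest k u' -> leaves_up k v' ->
  u ++ v = u' ++ v' -> u = u' /\ v = v'.
Proof.
wlog le_uu' : u u' v v' / (size u <= size u')%N.
  move=> IH lu uv lu' uv' e; case: (leqP (size u) (size u')) => [|/ltnW] le.
    exact: IH.
  by have [] := IH _ _ _ _ le lu' uv' lu uv (esym e).
move=> _ uv lu' _ e; have [[|s z] u'E vE] := cat_eq_prefix e le_uu'.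
  by rewrite u'E cats0 vE.
have := lu' (size u); rewrite u'E ordinate_size_cat height_cat gerDl.
have := uv (size z); have /= e0 := ordinate_size_cat k (s :: z) v'.
rewrite vE /= e0 size_cat ltnS leq_addr => /(_ erefl).
by rewrite ltNge => /negP.
Qed.

(** * First return from below *)

Definition rev_blocks (Rs : seq (seq step)) :=
  flatten [seq D :: rev R | R <- Rs].

Lemma rev_rev_blocks Rs : rev (rev_blocks Rs) = blocks (rev Rs).
Proof.
elim: Rs => // R Rs IH; rewrite /rev_blocks /= -cat_cons rev_cat IH rev_cons revK.
by rewrite [rev (R :: Rs)]rev_cons -[rcons (rev Rs) R]cats1 blocks_cat /blocks /= cats0.
Qed.

Lemma perm_rev_blocks Rs : perm_eq (rev_blocks Rs) (blocks Rs).
Proof.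
elim: Rs => //= R Rs IH; rewrite blocks_cons /rev_blocks /= -cat_cons -cat_rcons.
by apply: perm_cat => //; rewrite perm_sym perm_rcons perm_cons perm_sym perm_rev.
Qed.

Definition below k w := forall i, (i < size w)%N -> ordinate k w i.+1 < 0.

(** A reversed excursion never rises above its starting level, and each block
    starts with a down step. *)
Lemma rev_blocks_below k Rs : all (excursion k) Rs -> below k (rev_blocks Rs).
Proof.
(* A weaker bound that, unlike the strict one, holds for the empty prefix and
   can be proved by induction on the number of blocks. *)
have le0 Rs' i : all (excursion k) Rs' -> ordinate k (rev_blocks Rs') i <= 0.
  elim: Rs' i => [|R {}Rs IH] i /=; first by rewrite /ordinate /= height_nil.
  move=> /andP[/excursionP[hR posR] exRs].
  case: i => [|i]; first by rewrite ordinate0.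
  rewrite /rev_blocks /= ordinate_cons.
  apply: (ordinate_cat_ind (Q := fun _ y => -1 + y <= 0)) => {}i.
    by move=> _; rewrite ordinate_rev hR; have := posR (size R - i)%N; lia.
  by rewrite height_rev hR; have := IH i exRs; rewrite -/(rev_blocks _); lia.
case: Rs => [|R Rs] // /andP[/excursionP[hR posR] exRs] i _.
rewrite /rev_blocks /= ordinate_cons.
apply: (ordinate_cat_ind (Q := fun _ y => -1 + y < 0)) => {}i.
  by move=> _; rewrite ordinate_rev hR; have := posR (size R - i)%N; lia.
by rewrite height_rev hR; have := le0 _ i exRs; rewrite -/(rev_blocks _); lia.
Qed.

(** Read backwards, the word starts with [m] first passages, and a remainder [T]
    of height zero.  Since [rev T] is a prefix of the word, it would be a return
    to the axis if it were not empty. *)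
Lemma below_rev_blocks k w m : below k w -> height k w = - m%:Z ->
  exists Rs, [/\ w = rev_blocks Rs, size Rs = m & all (excursion k) Rs].
Proof.
move=> bel hw.
have [|Rs [T [wE sz exRs]]] := @passages k m (rev w).
  by rewrite height_rev hw.
have T0 : T = [::].
  have hT : height k T = 0.
    have := hw; rewrite -height_rev wE height_cat height_blocks // sz; lia.
  case: T wE hT => // s T wE hT.
  have := bel (size T); rewrite -[w]revK wE rev_cat size_cat !size_rev.
  have := ordinate_size_cat k (rev (s :: T)) (rev (blocks Rs)).
  rewrite size_rev height_rev hT /= => ->; rewrite ltxx.
  by rewrite ltnS leq_addr => /(_ erefl).
exists (rev Rs); rewrite size_rev all_rev; split=> //.
by apply: (can_inj revK); rewrite rev_rev_blocks revK wE T0 cats0.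
Qed.

(** The first step that ends at or above the axis comes from a point below the
    axis or is the first step of the word; in both cases only [U] is possible,
    in the second one because an initial [H] is excluded. *)
Lemma first_return k w : w != [::] -> ohead w <> Some H -> height k w = 0 ->
  exists X Z, [/\ w = X ++ U :: Z, below k X & - k%:Z <= height k X <= 0].
Proof.
move=> w0 noH hw.
have ex : exists i, 0 <= ordinate k w i.+1.
  by exists (size w); rewrite ordinate_oversize ?hw.
case: (ex_minnP ex) => j posj minj.
have neg i : (i < j)%N -> ordinate k w i.+1 < 0.
  by move=> ltij; rewrite ltNge; apply/negP => /minj; lia.
have ltjw : (j < size w)%N.
  case: w w0 hw {noH ex neg posj} minj => // s w _ hw; apply.
  by rewrite ordinate_oversize ?hw.
have wE : w = take j w ++ nth H w j :: drop j.+1 w.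
  by rewrite -drop_nth // cat_take_drop.
move: posj; rewrite ordinateS // => posj.
have [sU hj] : nth H w j = U /\ ordinate k w j <= 0.
  case: j neg posj {minj ltjw wE} => [|j] neg.
    by case: w w0 noH {hw ex neg} => [|[] w] //= _ noH; rewrite ordinate0.
  move=> posj; have := neg j (ltnSn j); move: posj; rewrite /dy.
  by case: (nth H w j.+1) => h1 h2; split=> //; lia.
exists (take j w), (drop j.+1 w); rewrite -sU; split=> //.
  move=> i; rewrite size_take ltjw => ltij.
  by rewrite /ordinate take_takel //; apply: neg.
by move: posj; rewrite sU [height _ _ <= _]hj -/(ordinate k w j) /dy; lia.
Qed.

(** If one prefix were longer, it would contain the up step after the other one
    and hence a point that is not below the axis. *)
Lemma first_return_uniq k X Z X' Z' :
  below k X -> 0 <= height k X + k%:Z -> below k X' -> 0 <= height k X' + k%:Z ->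
  X ++ U :: Z = X' ++ U :: Z' -> X = X' /\ Z = Z'.
Proof.
wlog le_XX' : X X' Z Z' / (size X <= size X')%N.
  move=> IH b h b' h' e; case: (leqP (size X) (size X')) => [|/ltnW] le.
    exact: IH.
  by have [] := IH _ _ _ _ le b' h' b h (esym e).
move=> _ h b' _ e; have [[|s z] X'E /= zs] := cat_eq_prefix e le_XX'.
  by rewrite X'E cats0; case: zs.
case: zs => zs _.
have := b' (size X); rewrite X'E -zs -addn1 ordinate_catr /ordinate /= take0.
rewrite !heightE size_cat /= => /(_ _); rewrite /dy.
by case: ltnP; lia.
Qed.

(** * Pieces of a path with a selected peak *)

Definition pieces k Rs P' P'' :=
  [/\ size Rs = k, all (excursion k) Rs, leaves_up k P', ends_lowest k P''
    & height k P' + height k P'' = 0].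

(** The selected peak is the [U] in the middle with the [D] of the block of the
    empty excursion: [d_1] follows it at once because the hump is a peak, and
    [R_1] is placed at the beginning of the path instead. *)
Definition assemble (Rs : seq (seq step)) P' P'' :=
  (head [::] Rs ++ P') ++ U :: blocks ([::] :: behead Rs) ++ P''.

Definition rearrange c (Rs : seq (seq step)) P' P'' :=
  rev_blocks (take c.-1 Rs) ++ U :: blocks (drop c.-1 Rs) ++ P'' ++ P'.

Lemma perm_rearrange c k Rs P' P'' : (0 < k)%N -> size Rs = k ->
  perm_eq (rearrange c Rs P' P'') (assemble Rs P' P'').
Proof.
case: Rs => [|R Rs] k0 sz; first by rewrite -sz in k0.
apply/permP => p; rewrite /rearrange /assemble !count_cat /= !count_cat.
rewrite (permP (perm_rev_blocks _) p).
have := congr1 (count p \o blocks) (cat_take_drop c.-1 (R :: Rs)).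
rewrite /= blocks_cat !blocks_cons !count_cat /= -/(blocks Rs); lia.
Qed.

(** Up to the peak the path is nonnegative since [R_1] is an excursion and [P']
    leaves up, to the height [h] where the selected [U] starts.  The [k] blocks that follow [U]
    descend from [h + k] to [h], and [P''] descends from [h] to its lowest
    level, the axis. *)
Lemma assemble_kapath k a n c Rs P' P'' : (0 < k)%N -> pieces k Rs P' P'' ->
  superpath k a n (rearrange c Rs P' P'') <-> kapath k a n (assemble Rs P' P'').
Proof.
move=> k0 [sz exRs up low h0].
have perm := perm_rearrange c P' P'' k0 sz.
have superE : superpath k a n (rearrange c Rs P' P'') <->
    superpath k a n (assemble Rs P' P'').
  by rewrite /superpath /= (perm_all _ perm) (height_perm _ perm) /width
    (perm_big _ perm).
rewrite /kapath /= superE; split=> [sup|[]//]; split=> // i.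
case: Rs sz exRs {sup superE perm} => [|R Rs] sz; first by rewrite -sz in k0.
move=> /= /andP[/excursionP[hR posR] exRs].
rewrite -[assemble _ _ _]/((R ++ P') ++ U :: blocks ([::] :: Rs) ++ P'').
have exQs : all (excursion k) ([::] :: Rs).
  by rewrite /= exRs andbT excursion_nil.
have posA j : 0 <= ordinate k (R ++ P') j.
  apply: (ordinate_cat_ind (Q := fun _ y => 0 <= y)) => {}j // .
  by rewrite hR add0r; apply: leaves_up_ge0.
apply: (ordinate_cat_ind (Q := fun _ y => 0 <= y)) => {}i //.
have := leaves_up_ge0 (size P') up; rewrite ordinate_oversize // => hP'.
rewrite height_cat hR add0r; case: i => [|i]; rewrite ?ordinate0 ?ordinate_cons ?addr0 //.
apply: (ordinate_cat_ind (Q := fun _ y => 0 <= height k P' + (dy k U + y))) => {}i.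
  by have := ordinate_blocks_ge i exQs; move: sz; rewrite /= /dy; lia.
by have := low i; rewrite height_blocks //=; move: sz; rewrite /= /dy; lia.
Qed.

Lemma find_iota (p : pred nat) b m q : (b <= q < b + m)%N -> p q ->
  (forall r, (b <= r < q)%N -> ~~ p r) -> (b + find p (iota b m) = q)%N.
Proof.
move=> /andP[le_bq lt_q] pq before.
have -> : (m = (q - b) + (m - (q - b)).-1.+1)%N by lia.
rewrite iotaD find_cat size_iota subnKC //= pq addn0.
case: hasP => [[r]|_]; last by rewrite subnKC.
rewrite mem_iota subnKC // => br pr.
by have := before r br; rewrite pr.
Qed.

(** Between the selected [U] and the [D] that ends the block of [Q], the path
    stays at or above the level of that block, so no earlier step ends at the
    lower level that [is_d] asks for. *)
Lemma dpos_blocks k A Rs Q V : all (excursion k) Rs -> excursion k Q ->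
  dpos k (A ++ U :: blocks Rs ++ Q ++ D :: V) (size A) (size Rs).+1
    = ((size A).+1 + size (blocks Rs) + size Q)%N.
Proof.
move=> exRs /excursionP[hQ posQ]; set w := A ++ _.
set q := (X in _ = X).
have ordA : ordinate k w (size A) = height k A by rewrite ordinate_size_cat.
have ord i : ordinate k w ((size A).+1 + i)
    = height k A + k%:Z + ordinate k (blocks Rs ++ Q ++ D :: V) i.
  by rewrite addSnnS ordinate_catr ordinate_cons addrA.
rewrite /dpos; apply: find_iota.
- by rewrite /q /w !size_cat /= !size_cat /=; lia.
- have q1 : (q.+1 = (size A).+1 + (size (blocks Rs) + (size Q + 1)))%N.
    by rewrite /q; lia.
  rewrite /is_d ordA q1 /q -addnA !ord !ordinate_catr ordinate_size_cat.
  rewrite ordinate_cons ordinate0 hQ height_blocks // /dy.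
  by apply/andP; split; apply/eqP; lia.
- move=> r; rewrite /q => ltr; rewrite /is_d ordA negb_and; apply/orP; right.
  have -> : (r.+1 = (size A).+1 + (r - size A))%N by lia.
  rewrite ord; have : (r - size A <= size (blocks Rs) + size Q)%N by lia.
  move: (r - _)%N => i lei.
  suff : - (size Rs)%:Z <= ordinate k (blocks Rs ++ Q ++ D :: V) i.
    by move=> ?; apply/eqP; lia.
  rewrite catA ordinate_catl ?size_cat //.
  apply: (ordinate_cat_ind (Q := fun _ y => _ <= y)) => {lei}i.
    by move=> _; apply: ordinate_blocks_ge.
  by rewrite height_blocks // lerDl.
Qed.

(** The excursion [R] ends on the axis, and [P'] does not touch it again. *)
Lemma last_axis_cat k R P' V : excursion k R -> leaves_up k P' ->
  last_axis k ((R ++ P') ++ V) (size (R ++ P')) = size R.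
Proof.
move=> /excursionP[hR _] up; rewrite /last_axis size_cat -addnS iotaD add0n.
rewrite filter_cat /= -catA ordinate_size_cat hR eqxx last_cat /=.
rewrite (@eq_in_filter _ _ pred0) ?filter_pred0 // => r; rewrite mem_iota => ltr.
have -> : (r = size R + (r - (size R).+1).+1)%N by lia.
rewrite ordinate_catr hR add0r ordinate_catl; last by lia.
by apply/negbTE; rewrite gt_eqF // up //; lia.
Qed.

Lemma section_cat (u v w : seq step) :
  section (u ++ v ++ w) (size u) (size u + size v) = v.
Proof. by rewrite /section catA take_size_cat ?size_cat // drop_size_cat. Qed.

Lemma map_nth_index_iota (T T' : Type) (f : T -> T') x0 s b e : (e <= size s)%N ->
  [seq f (nth x0 s i.-1) | i <- index_iota b.+1 e.+1]
    = map f (drop b (take e s)).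
Proof.
move=> le_es.
apply: (@eq_from_nth _ (f x0)) => [|i].
  by rewrite !size_map size_iota size_drop size_take_min; lia.
rewrite size_map size_iota => lti.
rewrite (nth_map 0%N) ?size_iota // nth_iota // (nth_map x0); last first.
  by rewrite size_drop size_take_min; lia.
by rewrite nth_drop nth_take //; lia.
Qed.

(** The steps [d_i] are the down steps of the blocks, and the last visit to the
    axis before the peak is the end of [R_1]. *)
Lemma phi_assemble k c Rs P' P'' : (0 < k)%N -> pieces k Rs P' P'' ->
  (1 <= c <= k.+1)%N ->
  phi k (ColoredWord (assemble Rs P' P'') (size (head [::] Rs ++ P')) c)
    = rearrange c Rs P' P''.
Proof.
move=> k0 [sz exRs up low h0] /andP[c0 lec]; rewrite /phi /=.
case: Rs sz exRs => [|R Rs] sz; first by rewrite -sz in k0.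
move=> /= /andP[exR exRs].
set w := assemble _ _ _; set l := size _.
(* The excursions between consecutive [d_i]: the first one is empty, as [R_1] is
   not located there. *)
pose Qs := [::] :: Rs.
have exQs : all (excursion k) Qs.
  by rewrite /= exRs andbT excursion_nil.
have wE i : (i < k)%N -> w = (R ++ P') ++ U :: blocks (take i Qs) ++
    nth [::] Qs i ++ D :: blocks (drop i.+1 Qs) ++ P''.
  move=> ltik; rewrite -[w]/((R ++ P') ++ U :: blocks Qs ++ P'') -[in LHS](cat_take_drop i Qs).
  rewrite (drop_nth [::]); last by move: sz => /= ->.
  by rewrite blocks_cat blocks_cons /= -!catA.
have szQ i : (i < k)%N -> size (take i Qs) = i.
  by move=> ltik; rewrite size_takel //; move: sz => /= ->; lia.
have dE i : (i < k)%N -> dpos k w l i.+1 =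
    (l.+1 + size (blocks (take i Qs)) + size (nth [::] Qs i))%N.
  move=> ltik; rewrite -[in X in dpos _ _ _ X](szQ i ltik) (wE i ltik).
  apply: dpos_blocks; first by apply/allP => Q /mem_take; apply/allP.
  by apply: (allP exQs); rewrite mem_nth //; move: sz => /= ->.
have dS i : (i.+1 < k)%N -> (dpos k w l i.+1).+1 =
    (l.+1 + size (blocks (take i.+1 Qs)))%N.
  move=> ltik; rewrite dE 1?ltnW // (take_nth [::]); last first.
    by move: sz => /= ->; lia.
  rewrite -cats1 blocks_cat size_cat /blocks /= cats0 size_rcons.
  by lia.
have axis : last_axis k w l = size R by exact: last_axis_cat.
have RE i : (i < k)%N -> partR k w l i.+1 = nth [::] (R :: Rs) i.
  case: i => [|i] ltik; rewrite /partR [_ == _]/=.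
    by rewrite axis /w /assemble /= -catA take_size_cat.
  rewrite -[RHS]/(nth [::] Qs i.+1) [_.-1]/= dS // dE //.
  have -> : (l.+1 + size (blocks (take i.+1 Qs)) =
      size (rcons (R ++ P') U ++ blocks (take i.+1 Qs)))%N.
    by rewrite size_cat size_rcons.
  by rewrite {1}(wE _ ltik) -cat_rcons catA section_cat.
have -> : partP' k w l = P'.
  rewrite /partP' axis /w /assemble /l size_cat /= -catA; exact: section_cat.
have -> : partH k w l = [::].
  by rewrite /partH dE //= /section !addn0 drop_oversize // size_take; case: ifP; lia.
have -> : partP'' k w l = P''.
  rewrite /partP''; case: (k) k0 dE wE sz => // j _ dE wE sz.
  rewrite dE // (wE j) // (drop_oversize (n := j.+1)); last by move: sz => /= ->.
  rewrite /= -cat_rcons catA -[D :: P'']cat1s !catA drop_size_cat //.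
  by rewrite !size_cat size_rcons /=; lia.
rewrite /rearrange; case: c c0 lec => // c _ lec /=.
congr (flatten _ ++ U :: flatten _ ++ _).
- rewrite -[in RHS](drop0 (take c _)) -(map_nth_index_iota _ [::]) ?sz //.
  by apply/eq_in_map => -[|i]; rewrite mem_index_iota // => ?; rewrite RE //; lia.
- rewrite -[in RHS](take_size (R :: Rs)) sz -(map_nth_index_iota _ [::]) ?sz //.
  by apply/eq_in_map => -[|i]; rewrite mem_index_iota // => ?; rewrite RE //; lia.
Qed.

(** The part before the peak is cut at its last minimum, which is on the axis;
    the part after the peak descends from [h + k - 1] to the axis, so that it
    makes [k - 1] first passages before it goes on from height [h]. *)
Lemma disassemble k a n P : (0 < k)%N -> peak_colored k.+1 k a n P ->
  exists Rs P' P'', pieces k Rs P' P'' /\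
    P = ColoredWord (assemble Rs P' P'') (size (head [::] Rs ++ P')) (color P).
Proof.
case: P => w l c k0 [/= [[_ _ hw] pos] [A [B [wE <-]]] _].
have [R [P' [AE low up]]] := last_minimum k A.
have hR : height k R = 0.
  apply/eqP; rewrite eq_le ends_lowest_height //=.
  by have := pos (size R); rewrite wE AE -catA ordinate_size_cat.
have exR : excursion k R by apply/excursionP; split=> // i; rewrite -hR.
have hP' := leaves_up_ge0 (size P') up; rewrite ordinate_oversize // in hP'.
have hA : height k A = height k P' by rewrite AE height_cat hR add0r.
have hB : height k P' + k%:Z - 1 + height k B = 0.
  by move: hw; rewrite wE /= !heightE hA /dy; lia.
have [|Rs [P'' [BE sz exRs]]] := @passages k k.-1 B; first by lia.
exists (R :: Rs), P', P''; split; last by rewrite wE BE AE.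
split=> //=; [by lia | by rewrite exR exRs | | ].
- apply: (@ends_lowest_catr k (blocks Rs)); rewrite -BE => i.
  have := pos (size A + i.+2)%N; rewrite wE ordinate_catr !ordinate_cons hA /dy.
  by lia.
- by move: hB; rewrite BE height_cat height_blocks // sz; lia.
Qed.

Lemma rearrange_return k c Rs P' P'' : pieces k Rs P' P'' -> (1 <= c <= k.+1)%N ->
  below k (rev_blocks (take c.-1 Rs))
  /\ height k (rev_blocks (take c.-1 Rs)) = - c.-1%:Z.
Proof.
move=> [sz exRs _ _ _] ltc; have exT : all (excursion k) (take c.-1 Rs).
  by apply/allP => R /mem_take; apply/allP.
split; first exact: rev_blocks_below.
by rewrite (height_perm _ (perm_rev_blocks _)) height_blocks // size_takel; lia.
Qed.

(** The cut at the first return gives the color, through the height at which it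
    occurs, and the remaining cuts give the pieces. *)
Lemma rearrange_inj k c c' Rs Rs' P' P'' Q' Q'' :
  pieces k Rs P' P'' -> (1 <= c <= k.+1)%N ->
  pieces k Rs' Q' Q'' -> (1 <= c' <= k.+1)%N ->
  rearrange c Rs P' P'' = rearrange c' Rs' Q' Q'' ->
  [/\ c = c', Rs = Rs', P' = Q' & P'' = Q''].
Proof.
move=> pc lec pc' lec' e.
have [bel hX] := rearrange_return pc lec.
have [bel' hX'] := rearrange_return pc' lec'.
have [||eX eZ] := first_return_uniq bel _ bel' _ e; [by lia | by lia |].
have ec : c = c' by move: hX; rewrite eX hX'; lia.
subst c'.
case: pc pc' => [sz exRs up low _] [sz' exRs' up' low' _].
have take_ex Ss : all (excursion k) Ss -> all (excursion k) (rev (take c.-1 Ss)).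
  by move=> /allP exSs; rewrite all_rev; apply/allP => R /mem_take /exSs.
have drop_ex Ss : all (excursion k) Ss -> all (excursion k) (drop c.-1 Ss).
  by move=> /allP exSs; apply/allP => R /mem_drop /exSs.
have [eT _] : rev (take c.-1 Rs) = rev (take c.-1 Rs') /\ [::] = [::] :> seq step.
  apply: (@passages_uniq k); rewrite ?take_ex ?size_rev ?size_take ?sz ?sz' //.
  by rewrite !cats0 -!rev_rev_blocks eX.
have [eD eW] : drop c.-1 Rs = drop c.-1 Rs' /\ P'' ++ P' = Q'' ++ Q'.
  by apply: (@passages_uniq k); rewrite ?drop_ex ?size_drop ?sz ?sz'.
have [-> ->] := last_minimum_uniq low up low' up' eW.
split=> //; rewrite -(cat_take_drop c.-1 Rs) -(cat_take_drop c.-1 Rs') eD.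
by rewrite (can_inj revK eT).
Qed.

(** The up step of the first return starts at some height [-m] with [m <= k]: the
    part before it gives [m] excursions and color [m + 1], and the part after it
    descends from [k - m] to the axis and gives the other [k - m]. *)
Lemma rearrange_surj k a n S : (0 < n)%N -> superpath_noH k a n S ->
  exists c Rs P' P'',
    [/\ pieces k Rs P' P'', (1 <= c <= k.+1)%N & S = rearrange c Rs P' P''].
Proof.
move=> n0 [[_ wS hS] noH].
have S0 : S != [::] by apply/eqP => S0; move: wS n0; rewrite S0 /width big_nil => <-.
have [X [Z [SE bel hX]]] := first_return S0 noH hS.
pose m := `|height k X|%N.
have hXm : height k X = - m%:Z by rewrite /m; lia.
have [Rs1 [XE sz1 ex1]] := below_rev_blocks bel hXm.
have hZ : height k Z = - (k - m)%N%:Z.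
  by move: hS; rewrite SE !heightE /dy; lia.
have [|Rs2 [W [ZE sz2 ex2]]] := @passages k (k - m) Z; first by rewrite hZ.
have [P'' [P' [WE low up]]] := last_minimum k W.
exists m.+1, (Rs1 ++ Rs2), P', P''; split; [split=> // | by lia |].
- by rewrite size_cat; lia.
- by rewrite all_cat ex1.
- by move: hZ; rewrite ZE WE !height_cat height_blocks // sz2; lia.
- by rewrite /rearrange /= take_size_cat // drop_size_cat // SE ZE WE XE.
Qed.

Lemma rearrange_noH k c Rs P' P'' : pieces k Rs P' P'' ->
  ohead (rearrange c Rs P' P'') <> Some H.
Proof. by rewrite /rearrange; case: (take _ _). Qed.

Theorem mainTheorem2 (k n : nat) (a : option nat)
    (hk : (1 <= k)%N) (hn : (1 <= n)%N)
    (ha : forall b : nat, a = Some b -> (1 <= b)%N) :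
  set_bij (peak_colored k.+1 k a n) (superpath_noH k a n) (phi k).
Proof.
split.
- move=> P PP; have [path _ lec] := PP.
  have [Rs [P' [P'' [pc PE]]]] := disassemble hk PP.
  rewrite PE phi_assemble //; split; last exact: rearrange_noH pc.
  by apply/(assemble_kapath _ _ _ hk pc); move: path; rewrite PE.
- move=> P Q /set_mem PP /set_mem QQ.
  have [_ _ lec] := PP; have [_ _ lec'] := QQ.
  have [Rs [P' [P'' [pc ->]]]] := disassemble hk PP.
  have [Ss [Q' [Q'' [qc ->]]]] := disassemble hk QQ.
  rewrite !phi_assemble // => e.
  by have [-> -> -> ->] := rearrange_inj pc lec qc lec' e.
- move=> S SS; have [c [Rs [P' [P'' [pc lec SE]]]]] := rearrange_surj hn SS.
  exists (ColoredWord (assemble Rs P' P'') (size (head [::] Rs ++ P')) c).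
    split=> //=; last by exists (head [::] Rs ++ P'), (blocks (behead Rs) ++ P'').
    by apply/(assemble_kapath a n c hk pc); rewrite -SE; case: SS.
  by rewrite phi_assemble.
Qed.
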